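(* Let $\sigma\in SO(3)$ and let $q\in\mathbb{H}_{\mathbb R}$ with $\mathrm{Sc}(q)\notin\{0,-1,-2,\dots\}$. Then $$\Gamma((1\otimes\sigma)(q))=(1\otimes\sigma)(\Gamma(q)).$$
   Context: $\mathbb{H}_{\mathbb R}$ is the real quaternion algebra with basis $1,e_1,e_2,e_3$; $q=a+v$ with scalar part $a=\mathrm{Sc}(q)$ and vector part $v=\sum_{j=1}^3v_je_j$, identified with $(v_1,v_2,v_3)\in\mathbb{R}^3$. For $\sigma\in SO(3)$, $(1\otimes\sigma)(a+v):=a+\sigma v$. The quaternionic Gamma function is, for $a>0$, $$\Gamma(q):=\int_0^\infty t^{a-1}\cos(|v|\log t)e^{-t}\,dt+\frac{v}{|v|}\int_0^\infty t^{a-1}\sin(|v|\log t)e^{-t}\,dt\in\mathbb{H}_{\mathbb R}$$ (second term $0$ if $v=0$), and these two integrals equal $\frac12(\Gamma(a-i|v|)+\Gamma(a+i|v|))$ and $\frac i2(\Gamma(a-i|v|)-\Gamma(a+i|v|))$ (complex Gamma function), by which $\Gamma(q)$ is extended to negative non-integer $a$. *)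

(* Defs.v *)
From mathcomp Require Import all_boot all_order all_algebra.
From mathcomp Require Import all_classical all_reals all_analysis.
From mathcomp Require Import complex.

Set Implicit Arguments.
Unset Strict Implicit.
Unset Printing Implicit Defensive.

Import Order.TTheory GRing.Theory Num.Theory.
Local Open Scope classical_set_scope.
Local Open Scope ring_scope.

(* q = a + v_1 e_1 + v_2 e_2 + v_3 e_3, the vector part being the column
   (v_1, v_2, v_3). *)
Record quaternion (R : realType) := Quaternion { Sc : R ; Vec : 'cV[R]_3 }.

(* The library norm on matrices is the sup norm, hence this definition. *)
Definition enorm (R : realType) (v : 'cV[R]_3) : R :=
  Num.sqrt (\sum_(i < 3) v i ord0 ^+ 2).

Definition SO3 (R : realType) (s : 'M[R]_3) : Prop :=
  s^T *m s = 1%:M /\ \det s = 1.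

(* The map 1 (x) s. *)
Definition rotq (R : realType) (s : 'M[R]_3) (q : quaternion R) : quaternion R :=
  Quaternion (Sc q) (s *m Vec q).

(* Since t ^ (a + i b - 1) = t ^ (a - 1) (cos (b log t) + i sin (b log t)), these
   are the real and imaginary parts of the Euler integral at a + i b. For a > 0
   they converge absolutely, so the Lebesgue integral is the improper one. *)
Definition euler_cos (R : realType) (a b : R) : R :=
  (\int[lebesgue_measure]_(t in `]0%R, +oo[)
     (t `^ (a - 1) * cos (b * ln t) * expR (- t)))%R.

Definition euler_sin (R : realType) (a b : R) : R :=
  (\int[lebesgue_measure]_(t in `]0%R, +oo[)
     (t `^ (a - 1) * sin (b * ln t) * expR (- t)))%R.

Definition euler_integral (R : realType) (z : R[i]) : R[i] :=
  Complex (euler_cos (complex.Re z) (complex.Im z))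
          (euler_sin (complex.Re z) (complex.Im z)).

(* The least n such that a + n > 0. *)
Definition gamma_shift (R : realType) (a : R) : nat :=
  if 0 < a then 0%N else (Num.truncn (- a)).+1.

(* The complex Gamma function: the Euler integral on the right half-plane,
   continued by Gamma (z) = Gamma (z + n) / (z (z + 1) ... (z + n - 1)).
   The values at the poles 0, -1, -2, ... are junk. *)
Definition GammaC (R : realType) (z : R[i]) : R[i] :=
  let n := gamma_shift (complex.Re z) in
  euler_integral (z + n%:R) / \prod_(k < n) (z + k%:R).

Definition Gamma_cos (R : realType) (a b : R) : R[i] :=
  2^-1 * (GammaC (Complex a (- b)) + GammaC (Complex a b)).

Definition Gamma_sin (R : realType) (a b : R) : R[i] :=
  Complex 0 1 / 2 * (GammaC (Complex a (- b)) - GammaC (Complex a b)).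

(* For Sc q <= 0 the two coefficients are real numbers given by complex
   formulas; complex.Re only casts them from R[i] to R (see Im_Gamma_cos and
   Im_Gamma_sin). *)
Definition GammaH (R : realType) (q : quaternion R) : quaternion R :=
  let a := Sc q in
  let v := Vec q in
  let r := enorm v in
  let c := if 0 < a then euler_cos a r else complex.Re (Gamma_cos a r) in
  let s := if 0 < a then euler_sin a r else complex.Re (Gamma_sin a r) in
  Quaternion c (if v == 0 then 0 else s *: (r^-1 *: v)).

Lemma euler_cosN (R : realType) (a b : R) : euler_cos a (- b) = euler_cos a b.
Proof. by apply: eq_Rintegral => t _; rewrite mulNr cosN. Qed.

Lemma euler_sinN (R : realType) (a b : R) : euler_sin a (- b) = - euler_sin a b.
Proof.
rewrite /euler_sin /Rintegral -fineN.
under eq_integral do rewrite mulNr sinN mulrN mulNr EFinN.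
rewrite [in LHS]integralE [in RHS]integralE.
rewrite funeposN funenegN.
set A := integral _ _ _; set B := integral _ _ _.
by case: A => [x||]; case: B => [y||] //=; rewrite opprB.
Qed.

Lemma euler_integral_conj (R : realType) (z : R[i]) :
  euler_integral (conjc z) = conjc (euler_integral z).
Proof. by case: z => a b; rewrite /euler_integral /= euler_cosN euler_sinN. Qed.

Lemma GammaC_conj (R : realType) (z : R[i]) : GammaC (conjc z) = conjc (GammaC z).
Proof.
rewrite /GammaC; have -> : complex.Re (conjc z) = complex.Re z by case: z.
set n := gamma_shift _.
have conjn k : conjc z + k%:R = conjc (z + k%:R).
  by rewrite [RHS]rmorphD /= [conjc k%:R]rmorph_nat.
rewrite conjn euler_integral_conj.
under eq_bigr do rewrite conjn.
rewrite [RHS]rmorphM /= [conjc _^-1]fmorphV; congr (_ / _).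
by rewrite -[RHS]/((@conjc R : {rmorphism _ -> _}) _) rmorph_prod.
Qed.

Lemma Gamma_cosE (R : realType) (a b : R) :
  Gamma_cos a b = Complex (complex.Re (GammaC (Complex a b))) 0.
Proof.
rewrite /Gamma_cos -[Complex a (- b)]/(conjc (Complex a b)) GammaC_conj.
case: (GammaC _) => x y.
have h : (2 : R[i]) != 0 by rewrite pnatr_eq0.
apply: (mulfI h); rewrite mulrA divff // mul1r mulr_natl mulr2n.
by apply/eqP; rewrite eq_complex /= addNr addr0 !eqxx.
Qed.

Lemma Gamma_sinE (R : realType) (a b : R) :
  Gamma_sin a b = Complex (complex.Im (GammaC (Complex a b))) 0.
Proof.
rewrite /Gamma_sin -[Complex a (- b)]/(conjc (Complex a b)) GammaC_conj.
case: (GammaC _) => x y.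
have h : (2 : R[i]) != 0 by rewrite pnatr_eq0.
apply: (mulfI h); rewrite mulrA mulrCA divff // mulr1 mulr_natl mulr2n.
apply/eqP; rewrite eq_complex /= !mul0r !mul1r !add0r subrr ?addr0 opprD.
by rewrite !opprK !eqxx.
Qed.

Lemma Im_Gamma_cos (R : realType) (a b : R) : complex.Im (Gamma_cos a b) = 0.
Proof. by rewrite Gamma_cosE. Qed.

Lemma Im_Gamma_sin (R : realType) (a b : R) : complex.Im (Gamma_sin a b) = 0.
Proof. by rewrite Gamma_sinE. Qed.

(* For a > 0 the complex formulas agree with the integrals. *)
Lemma GammaC_euler (R : realType) (z : R[i]) :
  0 < complex.Re z -> GammaC z = euler_integral z.
Proof. by move=> h; rewrite /GammaC /gamma_shift h big_ord0 addr0 divr1. Qed.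

Lemma Gamma_cos_euler (R : realType) (a b : R) :
  0 < a -> Gamma_cos a b = Complex (euler_cos a b) 0.
Proof. by move=> a0; rewrite Gamma_cosE GammaC_euler. Qed.

Lemma Gamma_sin_euler (R : realType) (a b : R) :
  0 < a -> Gamma_sin a b = Complex (euler_sin a b) 0.
Proof. by move=> a0; rewrite Gamma_sinE GammaC_euler. Qed.

Lemma gamma_shift_gt0 (R : realType) (a : R) : 0 < a + (gamma_shift a)%:R.
Proof.
rewrite /gamma_shift; case: (ltP 0 a) => [a0|a0] /=; first by rewrite addr0.
have /andP[_ +] := @truncn_itv R (- a) (etrans (oppr_ge0 a) a0).
by rewrite -subr_gt0 opprK addrC.
Qed.

(* Main.v *)
Require Import Defs.
From mathcomp Require Import all_boot all_order all_algebra.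
From mathcomp Require Import all_classical all_reals all_analysis.

Import GRing.Theory.

Local Open Scope ring_scope.

(** Both coefficients of [GammaH q] depend only on [Sc q] and the Euclidean norm of [Vec q]. A
    rotation fixes the first and, being orthogonal, the second ([enorm_orthogonal]). What remains is
    the direction [r^-1 *: v], which is linear in [v] for fixed [r] and so commutes with [sigma]. *)

Lemma enormE (R : realType) (v : 'cV[R]_3) :
  enorm v = Num.sqrt ((v^T *m v) ord0 ord0).
Proof.
by congr Num.sqrt; rewrite mxE; apply: eq_bigr => i _; rewrite mxE expr2.
Qed.

Lemma enorm_orthogonal (R : realType) (s : 'M[R]_3) (v : 'cV[R]_3) :
  s^T *m s = 1%:M -> enorm (s *m v) = enorm v.
Proof.
by move=> sTs; rewrite !enormE trmx_mul mulmxA -(mulmxA v^T) sTs mulmx1.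
Qed.

(** Ensures that the case split on a zero vector part in [GammaH] takes the same branch for [q] and
    its rotation. *)
Lemma mulmx_linv_eq0 (R : pzRingType) (m n p : nat) (A : 'M[R]_(m, n))
    (B : 'M[R]_(n, m)) (v : 'M[R]_(n, p)) :
  B *m A = 1%:M -> (A *m v == 0) = (v == 0).
Proof.
move=> BA; apply/eqP/eqP => [Av0|->]; last by rewrite mulmx0.
by rewrite -[v]mul1mx -BA -mulmxA Av0 mulmx0.
Qed.

Theorem lemma3 (R : realType) (sigma : 'M[R]_3) (q : quaternion R) :
  SO3 sigma ->
  (forall n : nat, Sc q <> - n%:R) ->
  GammaH (rotq sigma q) = rotq sigma (GammaH q).
Proof.
move=> [sTs _] _; rewrite /GammaH /rotq /=.
rewrite (enorm_orthogonal _ _ _ sTs) (mulmx_linv_eq0 _ _ _ _ _ _ _ sTs).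
(* The coefficients now agree; only linearity of [sigma] is left. *)
by case: (Vec q == 0); rewrite ?mulmx0 // -!scalemxAr.
Qed.
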